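(* Let $\Gamma$ be a group, let $n\ge2$, and let $f\colon\Gamma\to\mathrm{Sym}(n)$ be a group homomorphism that defines a transitive action of $\Gamma$ on $[n]$. Let $\hat f=\Psi_n\circ f\colon\Gamma\to\mathrm{Sym}(n-1)$, and let $h\colon\Gamma\to\mathrm{Sym}(n-1)$ be an arbitrary group homomorphism. Then $\mathrm{def}_\infty(\hat f)\le\frac2{n-1}$ and $d_\infty(h,\hat f)\ge\frac12-\frac1{n-1}$. Furthermore, if $\Gamma$ is a discrete amenable group equipped with a right-invariant measure $m$, then $\mathrm{def}_1(\hat f)\le\frac2{n-1}$ and $d_1(h,\hat f)\ge\frac14-\frac1{n-1}$.
   Context: Write $[n]=\{1,\dots,n\}$. The map $\Psi_n\colon\mathrm{Sym}(n)\to\mathrm{Sym}(n-1)$ is given, for $\sigma\in\mathrm{Sym}(n)$ and $x\in[n-1]$, by $\Psi_n(\sigma)(x)=\sigma(x)$ if $\sigma(x)\ne n$ and $\Psi_n(\sigma)(x)=\sigma(\sigma(x))$ if $\sigma(x)=n$. For $\sigma,\tau\in\mathrm{Sym}(k)$, $d^H(\sigma,\tau)=\frac1k|\{x\in[k] : \sigma(x)\ne\tau(x)\}|$. A measure on a discrete group $\Gamma$ means a finitely additive probability measure $m\colon\mathcal P(\Gamma)\to[0,1]$ defined on all subsets; it is right invariant if $m(A\gamma)=m(A)$ for all $A\subset\Gamma$, $\gamma\in\Gamma$. Bounded functions on $\Gamma$ are integrated with respect to $m$ (the positive linear functional on bounded functions with $\int\mathbf1_A\,dm=m(A)$). For functions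 $g,h\colon\Gamma\to\mathrm{Sym}(k)$: $\mathrm{def}_\infty(g)=\sup_{\gamma_1,\gamma_2\in\Gamma}d^H(g(\gamma_1\gamma_2),g(\gamma_1)g(\gamma_2))$; $d_\infty(g,h)=\sup_{\gamma\in\Gamma}d^H(g(\gamma),h(\gamma))$; $\mathrm{def}_1(g)=\int\left(\int d^H(g(\gamma_1\gamma_2),g(\gamma_1)g(\gamma_2))\,dm(\gamma_1)\right)dm(\gamma_2)$; $d_1(g,h)=\int d^H(g(\gamma),h(\gamma))\,dm(\gamma)$. *)

(* Defs.v *)
From HB Require Import structures.
From mathcomp Require Import all_boot all_order all_algebra all_fingroup.
From mathcomp Require Import lra.
From mathcomp Require Import mathcomp_extra boolp classical_sets reals.

Set Implicit Arguments.
Unset Strict Implicit.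
Unset Printing Implicit Defensive.

Import Order.TTheory GRing.Theory Num.Theory.
Local Open Scope classical_set_scope.
Local Open Scope ring_scope.

(* The set [n] = {1, ..., n} is rendered as 'I_n = {0, ..., n - 1}, so that the
   last point n of [n] is the ordinal of value n.-1, and [n - 1] is included in
   [n] by widening. *)

(* The product of Sym(n) as composition, (s t)(x) = s (t x). MathComp's product
   of permutations composes in the opposite order. *)
Definition sym_mul (n : nat) (s t : {perm 'I_n}) : {perm 'I_n} := (t * s)%g.

Lemma sym_mulE (n : nat) (s t : {perm 'I_n}) (x : 'I_n) :
  sym_mul s t x = s (t x).
Proof. exact: permM. Qed.

Definition is_sym_hom (Gamma : groupType) (n : nat) (f : Gamma -> {perm 'I_n}) :=
  forall a b : Gamma, f (a * b)%g = sym_mul (f a) (f b).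

Definition is_transitive (Gamma : groupType) (n : nat)
    (f : Gamma -> {perm 'I_n}) :=
  forall x y : 'I_n, exists g : Gamma, f g x = y.

(* Psi s is the map Psi_n(s) of Sym(n - 1), for s in Sym(n). Psi_val s x is its
   value at x as an element of [n], which never is the last point of [n]. *)
Section Psi.
Variables (n : nat) (s : {perm 'I_n}).

Definition Psi_val (x : 'I_n.-1) : 'I_n :=
  let y := s (widen_ord (leq_pred n) x) in
  if val y != n.-1 then y else s y.

Lemma Psi_val_subproof (x : 'I_n.-1) : (Psi_val x < n.-1)%N.
Proof.
have lt_last (z : 'I_n) : val z != n.-1 -> (z < n.-1)%N.
  by case: z => z /=; case: (n) => // m; rewrite ltnS ltn_neqAle => -> ->.
rewrite /Psi_val; set w := widen_ord _ x.
case: (boolP (val (s w) == n.-1)) => [/eqP sw|]; last exact: lt_last.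
apply: lt_last; apply/eqP => ssw; have := ltn_ord x.
have /perm_inj ww : s (s w) = s w by apply: val_inj; rewrite ssw sw.
by move: sw; rewrite ww => /= xn; rewrite [X in (X < _)%N]xn ltnn.
Qed.

Definition Psi_fun (x : 'I_n.-1) : 'I_n.-1 := Ordinal (Psi_val_subproof x).

Lemma Psi_fun_inj : injective Psi_fun.
Proof.
move=> x y /(congr1 val) /= /val_inj.
have wE (z : 'I_n.-1) (u : 'I_n) : val u = n.-1 -> widen_ord (leq_pred n) z <> u.
  by move=> ulast /(congr1 val) /= zu; have := ltn_ord z; rewrite {1}zu [X in (X < _)%N]ulast ltnn.
rewrite /Psi_val; case: eqP => sx; case: eqP => sy /= /perm_inj.
- move=> sxy; apply: val_inj.
  by have /perm_inj/(congr1 val) := sxy.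
- by move=> /esym/wE; case.
- by move=> /wE; case.
- by move=> /(congr1 val) /= xy; apply: val_inj.
Qed.

Definition Psi : {perm 'I_n.-1} := perm Psi_fun_inj.

End Psi.

Section Distances.
Variables (R : realType) (Gamma : groupType) (k : nat).
Implicit Types (s t : {perm 'I_k}) (g h : Gamma -> {perm 'I_k}).

Definition dH s t : R := #|[pred x | s x != t x]|%:R / k%:R.

Definition def_infty g : R :=
  sup [set dH (g (p.1 * p.2)%g) (sym_mul (g p.1) (g p.2)) | p in [set: Gamma * Gamma]].

Definition d_infty g h : R := sup [set dH (g a) (h a) | a in [set: Gamma]].

End Distances.
Arguments dH {R k} s t.
Arguments def_infty {R Gamma k} g.
Arguments d_infty {R Gamma k} g h.

Record fa_probability (R : realType) (T : Type) := FAProbability {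
  fa_measure :> set T -> R;
  fa_measure01 : forall A, 0 <= fa_measure A <= 1;
  fa_measureT : fa_measure setT = 1;
  fa_measureU : forall A B, A `&` B = set0 ->
    fa_measure (A `|` B) = fa_measure A + fa_measure B }.

Definition right_invariant (R : realType) (Gamma : groupType)
    (m : fa_probability R Gamma) :=
  forall (A : set Gamma) (c : Gamma), m [set (a * c)%g | a in A] = m A.

Section Integral.
Variables (R : realType) (T : Type) (m : fa_probability R T).
Implicit Types (phi psi : T -> R) (I : (T -> R) -> R).

Definition is_bounded phi := has_ubound (range (fun x => `|phi x|)).

Definition is_fa_integral I :=
  [/\ forall (a : R) phi psi, is_bounded phi -> is_bounded psi ->
        I (fun x => a * phi x + psi x) = a * I phi + I psi,
      forall phi, is_bounded phi -> (forall x, 0 <= phi x) -> 0 <= I phi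
    & forall A : set T, I (fun x => (x \in A)%:R) = m A].

(* The integral of bounded functions, as the positive linear functional that
   maps every indicator function to the measure of its set.
   Such a functional exists (fa_integralP below) and its values at bounded
   functions are determined by m (fa_integral_unique below); its values at
   unbounded functions are irrelevant. *)
Definition fa_integral : (T -> R) -> R := xget (fun=> 0) is_fa_integral.

Let simple (s : seq (R * set T)) x : R := \sum_(p <- s) p.1 * (x \in p.2)%:R.
Let simple_int (s : seq (R * set T)) : R := \sum_(p <- s) p.1 * m p.2.

Let m_ge0 A : 0 <= m A.
Proof. by have /andP[] := fa_measure01 m A. Qed.

Let m_set0 : m set0 = 0.
Proof.
have /esym/eqP := fa_measureU m (setI0 set0).
by rewrite setU0 -subr_eq0 addrK => /eqP.
Qed.

Let m_split A B : m B = m (B `&` A) + m (B `\` A).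
Proof. by rewrite -fa_measureU ?setUIDK // setDE setIACA setICr setI0. Qed.

Let simple_ge0_on s : forall (B : set T) (c : R),
  (forall x, B x -> 0 <= c + simple s x) ->
  0 <= c * m B + \sum_(p <- s) p.1 * m (p.2 `&` B).
Proof.
elim: s => [|[a A] s IHs] B c cs_ge0.
  rewrite big_nil addr0; have [->|/set0P[x Bx]] := eqVneq B set0.
    by rewrite m_set0 mulr0.
  apply: mulr_ge0 => //.
  by have := cs_ge0 x Bx; rewrite /simple big_nil addr0.
rewrite big_cons /=.
have posI : 0 <= (c + a) * m (B `&` A) + \sum_(p <- s) p.1 * m (p.2 `&` (B `&` A)).
  apply: IHs => x [Bx Ax]; have := cs_ge0 x Bx.
  by rewrite /simple big_cons /= mem_set // mulr1 addrA.
have posD : 0 <= c * m (B `\` A) + \sum_(p <- s) p.1 * m (p.2 `&` (B `\` A)).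
  apply: IHs => x [Bx Ax]; have := cs_ge0 x Bx.
  by rewrite /simple big_cons /= memNset // mulr0 add0r.
apply: le_trans (addr_ge0 posI posD) _; rewrite le_eqVlt; apply/orP/or_introl/eqP.
rewrite addrACA -big_split /= addrA; congr (_ + _).
  by rewrite (m_split A B) mulrDl mulrDr (setIC A B) addrAC.
apply: eq_bigr => p _.
by rewrite (m_split A (p.2 `&` B)) mulrDr setIA setIDA.
Qed.

Let simple_int_ge0 s : (forall x, 0 <= simple s x) -> 0 <= simple_int s.
Proof.
move=> s_ge0; have := @simple_ge0_on s setT 0.
rewrite mul0r add0r /simple_int; under eq_bigr do rewrite setIT.
by apply=> x _; rewrite add0r.
Qed.

Let scale_simple (a : R) (s : seq (R * set T)) := [seq (a * p.1, p.2) | p <- s].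

Let simple_scale a s x : simple (scale_simple a s) x = a * simple s x.
Proof.
by rewrite /simple big_map mulr_sumr; apply: eq_bigr => p _; rewrite mulrA.
Qed.

Let simple_int_scale a s : simple_int (scale_simple a s) = a * simple_int s.
Proof.
by rewrite /simple_int big_map mulr_sumr; apply: eq_bigr => p _; rewrite mulrA.
Qed.

Let simple_cat s t x : simple (s ++ t) x = simple s x + simple t x.
Proof. by rewrite /simple big_cat. Qed.

Let simple_int_cat s t : simple_int (s ++ t) = simple_int s + simple_int t.
Proof. by rewrite /simple_int big_cat. Qed.

Let simple_const (c : R) x : simple [:: (c, setT)] x = c.
Proof. by rewrite /simple big_seq1 /= in_setT mulr1. Qed.

Let simple_int_const (c : R) : simple_int [:: (c, setT)] = c.
Proof. by rewrite /simple_int big_seq1 /= fa_measureT mulr1. Qed.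

Let simple_int_le s t :
  (forall x, simple s x <= simple t x) -> simple_int s <= simple_int t.
Proof.
move=> st; rewrite -subr_ge0 -mulN1r -simple_int_scale -simple_int_cat.
apply: simple_int_ge0 => x.
by rewrite simple_cat simple_scale mulN1r subr_ge0.
Qed.

Let staircase (e : R) (K : nat) phi : 0 < e ->
  (forall x, 0 <= phi x <= K%:R * e) ->
  exists s, forall x, 0 <= simple s x /\ simple s x <= phi x <= simple s x + e.
Proof.
move=> e_gt0; elim: K phi => [|K IHK] phi phiP.
  exists [::] => x; have := phiP x; rewrite /simple big_nil.
  by move=> /andP[? ?]; split=> //; apply/andP; split; lra.
have [x|s sP] := IHK (fun x => Num.max (phi x - e) 0).
  have /andP[p0] := phiP x; rewrite -natr1 mulrDl mul1r => p1.
  by rewrite le_max lexx orbT /= ge_max lerBlDr p1 mulr_ge0 ?ler0n // ltW.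
exists ((e, [set x | e <= phi x]) :: s) => x.
have [s0 /andP[s1 s2]] := sP x; have /andP[p0 _] := phiP x.
have -> : simple ((e, [set x | e <= phi x]) :: s) x
    = e * (x \in [set x | e <= phi x])%:R + simple s x.
  by rewrite /simple big_cons.
have [ep|pe] := leP e (phi x).
  rewrite mem_set // mulr1; move: s1 s2; rewrite max_l ?subr_ge0 // => s1 s2.
  by split; [lra | apply/andP; split; lra].
rewrite memNset /=; last by apply/negP; rewrite -ltNge.
move: s1 s2; rewrite max_r ?subr_le0 ?(ltW pe) // => s1 s2.
by split; [lra | apply/andP; split; lra].
Qed.

Let approx (e : R) phi : 0 < e -> is_bounded phi ->
  exists s, forall x, simple s x <= phi x <= simple s x + e.
Proof.
move=> e_gt0 [M phiM].
have {}phiM x : - M <= phi x <= M by rewrite -ler_norml; apply: phiM; exists x.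
have [K KP] : exists K : nat, M + M <= K%:R * e.
  exists (Num.truncn ((M + M) / e)).+1.
  by rewrite -ler_pdivrMr // ltW // truncnS_gt.
have [x|s sP] := @staircase e K (fun x => phi x + M) e_gt0.
  by have /andP[? ?] := phiM x; apply/andP; split; lra.
exists ((- M, setT) :: s) => x; have [_ /andP[? ?]] := sP x.
have -> : simple ((- M, setT) :: s) x = - M + simple s x.
  by rewrite -cat1s simple_cat simple_const.
by apply/andP; split; lra.
Qed.

Let lower_sums phi : set R :=
  [set simple_int s | s in [set s | forall x, simple s x <= phi x]].

Let lower phi : R := sup (lower_sums phi).

Let lower_approx phi s (e : R) : (forall x, simple s x <= phi x <= simple s x + e) ->
  simple_int s <= lower phi <= simple_int s + e.
Proof.
move=> sP.
have ub : ubound (lower_sums phi) (simple_int s + e).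
  move=> _ [t /= tP <-]; rewrite -[e in leRHS]simple_int_const -simple_int_cat.
  apply: simple_int_le => x; rewrite simple_cat simple_const.
  by apply: le_trans (tP x) _; have /andP[] := sP x.
have mem : lower_sums phi (simple_int s).
  by exists s => //= x; have /andP[] := sP x.
apply/andP; split; first by apply: ub_le_sup => //; exists (simple_int s + e).
by apply: ge_sup => //; exists (simple_int s).
Qed.

Let small_eq0 (x C : R) : (forall e, 0 < e -> `|x| <= C * e) -> x = 0.
Proof.
move=> xP; apply/eqP/negPn/negP => x0.
have x_gt0 : 0 < `|x| by rewrite normr_gt0.
have C1 : 0 < `|C| + 1 by rewrite ltr_wpDl.
have d_gt0 : 0 < `|x| / (`|C| + 1) by rewrite divr_gt0.
have := xP _ d_gt0; rewrite mulrA ler_pdivlMr // mulrC ler_pM2r //.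
by have := ler_norm C; lra.
Qed.

Let lower_is_fa_integral : is_fa_integral lower.
Proof.
split.
- move=> a phi psi bphi bpsi; apply/eqP; rewrite -subr_eq0; apply/eqP.
  apply: (@small_eq0 _ (3%:R * (`|a| + 1))) => e e_gt0.
  have [s sP] := approx e_gt0 bphi; have [t tP] := approx e_gt0 bpsi.
  set u := (- (`|a| * e), setT) :: scale_simple a s ++ t.
  have uE x : simple u x = - (`|a| * e) + (a * simple s x + simple t x).
    by rewrite /u -cat1s !simple_cat simple_const simple_scale.
  have uI : simple_int u = - (`|a| * e) + (a * simple_int s + simple_int t).
    by rewrite /u -cat1s !simple_int_cat simple_int_const simple_int_scale.
  have key (y z : R) : z <= y <= z + e -> `|a * y - a * z| <= `|a| * e.
    move=> /andP[zy yz]; rewrite -mulrBr normrM ler_wpM2l //.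
    by rewrite ger0_norm ?subr_ge0 // lerBlDl.
  have uP x : simple u x <= a * phi x + psi x
      <= simple u x + (2%:R * `|a| * e + e).
    have := key _ _ (sP x); have /andP[? ?] := tP x; rewrite uE ler_norml.
    by move=> /andP[? ?]; apply/andP; split; lra.
  have /andP[u1 u2] := lower_approx uP.
  have /andP[t1 t2] := lower_approx tP.
  have := key _ _ (lower_approx sP); rewrite !ler_norml uI in u1 u2 *.
  have := mulr_ge0 (normr_ge0 a) (ltW e_gt0).
  by move=> ae /andP[s1 s2]; apply/andP; split; lra.
- move=> phi [M phiM] phi_ge0; apply: ub_le_sup; last first.
    exists [::]; last by rewrite /simple_int big_nil.
    by move=> x; rewrite /simple big_nil.
  exists M => _ [t /= tP <-]; rewrite -(simple_int_const M).
  apply: simple_int_le => x; rewrite simple_const (le_trans (tP x)) //.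
  by rewrite (le_trans (ler_norm _)) //; apply: phiM; exists x.
- move=> A; have := @lower_approx (fun x => (x \in A)%:R) [:: (1, A)] 0.
  rewrite /simple_int big_seq1 mul1r addr0 => H; apply/le_anti.
  rewrite andbC; apply: H => x.
  by rewrite /simple big_seq1 mul1r addr0 lexx.
Qed.

Lemma fa_integralP : is_fa_integral fa_integral.
Proof. by apply: xgetPex; exists lower; exact: lower_is_fa_integral. Qed.

Lemma fa_integral_unique I : is_fa_integral I ->
  forall phi, is_bounded phi -> I phi = fa_integral phi.
Proof.
suff uniq J : is_fa_integral J -> forall phi, is_bounded phi -> J phi = lower phi.
  by move=> IP phi bphi; rewrite (uniq I) // (uniq _ fa_integralP).
move=> [linJ posJ indJ] phi bphi.
have bD a f g : is_bounded f -> is_bounded g -> is_bounded (fun x => a * f x + g x).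
  move=> [M fM] [N gN]; exists (`|a| * M + N) => _ [x _ <-].
  rewrite (le_trans (ler_normD _ _)) // lerD //; last by apply: gN; exists x.
  by rewrite normrM ler_wpM2l //; apply: fM; exists x.
have bind A : is_bounded (fun x => (x \in A)%:R).
  by exists 1 => _ [x _ <-]; case: (x \in A); rewrite ?normr1 ?normr0.
have bsimple s : is_bounded (simple s) /\ J (simple s) = simple_int s.
  elim: s => [|[a A] s [bs Js]].
    have -> : simple [::] = fun x => (x \in set0)%:R.
      by apply/funext => x; rewrite /simple big_nil in_set0.
    by rewrite indJ m_set0 /simple_int big_nil; split=> //; exact: bind.
  have -> : simple ((a, A) :: s) = fun x => a * (x \in A)%:R + simple s x.
    by apply/funext => x; rewrite /simple big_cons.
  rewrite linJ // indJ Js /simple_int big_cons; split=> //; exact: bD.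
have Jle f g : is_bounded f -> is_bounded g -> (forall x, f x <= g x) -> J f <= J g.
  move=> bf bg fg; rewrite -subr_ge0 -mulN1r addrC -linJ //.
  apply: posJ => [|x]; first exact: bD.
  by rewrite mulN1r addrC subr_ge0.
apply/eqP; rewrite -subr_eq0; apply/eqP; apply: (@small_eq0 _ 1) => e e_gt0.
have [s sP] := approx e_gt0 bphi; have /andP[s1 s2] := lower_approx sP.
have [bs Js] := bsimple s; have [bt Jt] := bsimple (s ++ [:: (e, setT)]).
have l1 : simple_int s <= J phi.
  by rewrite -Js; apply: Jle => // x; have /andP[] := sP x.
have l2 : J phi <= simple_int s + e.
  rewrite -[e in leRHS]simple_int_const -simple_int_cat -Jt.
  apply: Jle => // x; rewrite simple_cat simple_const.
  by have /andP[] := sP x.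
by rewrite mul1r ler_norml; apply/andP; split; lra.
Qed.

End Integral.

Section MeanDistances.
Variables (R : realType) (Gamma : groupType) (m : fa_probability R Gamma).
Variables (k : nat).
Implicit Types (g h : Gamma -> {perm 'I_k}).

Definition def_1 g : R :=
  fa_integral m (fun c2 =>
    fa_integral m (fun c1 => dH (g (c1 * c2)%g) (sym_mul (g c1) (g c2)))).

Definition d_1 g h : R := fa_integral m (fun c => dH (g c) (h c)).

End MeanDistances.

(* Main.v *)
Require Import Defs.
From HB Require Import structures.
From mathcomp Require Import all_boot all_order all_algebra all_fingroup.
From mathcomp Require Import mathcomp_extra boolp classical_sets reals.
From mathcomp Require Import lra.
Set Implicit Arguments.
Unset Strict Implicit.
Unset Printing Implicit Defensive.
Import Order.TTheory GRing.Theory Num.Theory.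
Local Open Scope ring_scope.

(* The group Gamma acts on [n] x [n - 1] through f and h, hence through a finite
   group G, on which the mean becomes the uniform average. For x in [n - 1], the
   stabiliser of x under f has index n in G, and under h it has index at most n - 1;
   so the second stabiliser is not contained in the first one, and their intersection
   has index at least 2 in it. Hence, for each y, at most half of the g in G with
   h(g)x = y satisfy f(g)x = y, so that h and f agree at x at most half of the
   time. As Psi(s) differs from s at a single point at most, h and Psi o f are at mean
   distance at least 1/2 - 1/(n - 1), which gives both lower bounds. *)

(** * Stabilisers for two actions of a finite group *)

Lemma card_agreement_le_half (gT : finGroupType) (G : {group gT}) (T1 T2 : finType)
    (to1 : {action gT &-> T1}) (to2 : {action gT &-> T2}) (i : T2 -> T1)
    (x1 : T1) (x2 : T2) :
  [transitive G, on [set: T1] | to1] -> (#|T2| < #|T1|)%N ->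
  (2 * #|[set g in G | to1 x1 g == i (to2 x2 g)]| <= #|G|)%N.
Proof.
move=> G_trans ltT.
pose S1 := ('C_G[x1 | to1])%G; pose S2 := ('C_G[x2 | to2])%G.
have S1E : (#|T1| * #|S1| = #|G|)%N.
  rewrite -(card_orbit_in_stab to1 x1 (finset.subsetT G)).
  by rewrite (atransP G_trans) ?inE // cardsT.
have S2E : (#|orbit to2 G x2| * #|S2| = #|G|)%N.
  by rewrite (card_orbit_in_stab to2 x2 (finset.subsetT G)).
(* If [S2] were contained in [S1], then |G| <= |T2| |S1| < |T1| |S1| = |G|. *)
have nS : ~~ (S2 \subset S1 :&: S2).
  rewrite finset.subsetI subxx andbT; apply/negP => /subset_leq_card leS.
  have : (#|orbit to2 G x2| * #|S2| <= #|T2| * #|S1|)%N.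
    by rewrite leq_mul // max_card.
  by rewrite S2E -S1E leq_pmul2r ?cardG_gt0 // leqNgt ltT.
have S12 : (2 * #|S1 :&: S2| <= #|S2|)%N.
  rewrite -(Lagrange (finset.subsetIr S1 S2)) mulnC leq_pmul2l ?cardG_gt0 //.
  by rewrite indexg_gt1.
rewrite -[in leqLHS]sum1_card -[leqRHS]sum1_card.
rewrite (partition_big (to2 x2) predT) //= [leqRHS](partition_big (to2 x2) predT) //=.
rewrite big_distrr; apply: leq_sum => y _ /=.
rewrite !sum1dep_card.
set A := [set _ | _]; set B := [set _ | _].
(* Fix the value [y] of [to2 x2 g]. Given [g0] in [A], all of [A] lies in the coset of [S1 :&: S2]
   through [g0], while [B] contains the whole coset of [S2] through [g0]. *)
have [->|[g0 g0A]] := set_0Vmem A; first by rewrite cards0.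
have [g0G g01 g02] : [/\ g0 \in G, to1 x1 g0 = i y & to2 x2 g0 = y].
  by move: g0A; rewrite !inE => /andP[/andP[-> /eqP ->] /eqP ->].
have AS : A \subset ((S1 :&: S2) :* g0)%g.
  apply/fintype.subsetP => g; rewrite !inE => /andP[/andP[gG /eqP g1] /eqP g2].
  rewrite mem_rcoset !inE !groupM ?groupV //= !finset.sub1set !inE.
  by rewrite !actM g1 g2 -g01 -g02 !actK !eqxx.
have SB : (S2 :* g0)%g \subset B.
  apply/fintype.subsetP => g; rewrite mem_rcoset !inE finset.sub1set inE.
  move=> /andP[gG /eqP g2]; rewrite -(mulgKV g0 g) groupM //= actM g2 g02.
  by rewrite eqxx.
apply: leq_trans (leq_trans S12 _); last by rewrite -(card_rcoset S2 g0) subset_leq_card.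
by rewrite leq_pmul2l // -(card_rcoset (S1 :&: S2) g0) subset_leq_card.
Qed.

(** * Counting the points where [Psi s] and [s] differ *)

Section PsiCard.
Variable n : nat.
Implicit Types (s t : {perm 'I_n}).

Let w (x : 'I_n.-1) : 'I_n := widen_ord (leq_pred n) x.

(** The exceptional set of [Psi]: outside it [Psi s] agrees with [s]. It is empty when [s] fixes the
    last point. *)
Let last_pre s := [set x | val (s (w x)) == n.-1].

Let card_last_pre s : (#|last_pre s| <= 1)%N.
Proof.
apply/card_le1P => x; rewrite inE => /eqP sx y; rewrite !inE.
apply/eqP/eqP => [sy|->//].
apply/val_inj; have /perm_inj/(congr1 val) // : s (w y) = s (w x).
by apply/val_inj; rewrite /= sx sy.
Qed.

Let PsiE s x : x \notin last_pre s -> w (Psi s x) = s (w x).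
Proof. by rewrite inE => sx; apply: val_inj; rewrite /= permE /= /Psi_val sx. Qed.

Let w_inj : injective w.
Proof. by move=> x y /(congr1 val)/= xy; apply: val_inj. Qed.

(** A disagreement at [x] forces [t] or the product to send [x] to the last point, and each does so
    for at most one [x]. *)
Lemma card_Psi_mul_neq s t :
  (#|[pred x | Psi (sym_mul s t) x != sym_mul (Psi s) (Psi t) x]| <= 2)%N.
Proof.
apply: (@leq_trans #|last_pre t :|: last_pre (sym_mul s t)|).
  apply/subset_leq_card/fintype.subsetP => x; rewrite inE; apply: contraNT.
  rewrite finset.in_setU negb_or => /andP[xt xst]; apply/eqP/w_inj.
  rewrite PsiE // !sym_mulE PsiE ?PsiE //.
  (* The last use of [PsiE] needs [Psi t x] outside [last_pre s]; since [Psi t x] is [t x] here,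
     this is [xst]. *)
  by move: xst; rewrite !inE sym_mulE PsiE.
by rewrite (leq_trans (leq_card_setU _ _)) // (leq_add (card_last_pre _) (card_last_pre _)).
Qed.

(** The extra 1 pays for the point that [s] sends to the last point: [Psi s] may agree with [t]
    there, but [s] cannot. *)
Lemma card_Psi_eq_le s (t : {perm 'I_n.-1}) :
  (#|[pred x | t x == Psi s x]| <= #|[pred x | s (w x) == w (t x)]|.+1)%N.
Proof.
rewrite -addn1.
apply: (@leq_trans #|[set x | s (w x) == w (t x)] :|: last_pre s|).
  apply/subset_leq_card/fintype.subsetP => x; rewrite inE => /eqP tx.
  rewrite finset.in_setU orbC; case: (boolP (x \in last_pre s)) => //= xs.
  by rewrite inE tx PsiE.
by rewrite (leq_trans (leq_card_setU _ _)) // leq_add ?card_last_pre // cardsE.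
Qed.

End PsiCard.

(** * The normalised Hamming distance *)

Section HammingDistance.
Variables (R : realType) (k : nat).
Implicit Types (s t : {perm 'I_k}).

Lemma dH_ge0 s t : 0 <= dH s t :> R.
Proof. by rewrite divr_ge0. Qed.

Lemma dH_le1 s t : dH s t <= 1 :> R.
Proof.
(* For [k = 0] the inverse of 0 is 0, so the distance is 0. *)
rewrite /dH; have [k0|k_gt0] := posnP k; first by rewrite [X in X%:R^-1]k0 invr0 mulr0.
by rewrite ler_pdivrMr ?ltr0n // mul1r ler_nat (leq_trans (max_card _)) ?card_ord.
Qed.

Lemma dHE s t : (0 < k)%N -> dH s t = 1 - #|[pred x | s x == t x]|%:R / k%:R :> R.
Proof.
move=> k_gt0; have k_neq0 : k%:R != 0 :> R by rewrite pnatr_eq0 -lt0n.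
rewrite -[X in X - _](divff k_neq0) -mulrBl.
have /(congr1 (GRing.natmul (1 : R))) := cardC [pred x | s x == t x].
rewrite natrD card_ord addrC => /(canRL (addrK _)) <-.
by congr (_%:R / _); apply: eq_card.
Qed.

End HammingDistance.

(** * Finitely additive integrals and push-forward to a finite group *)

Section FaIntegral.
Variables (R : realType) (T : Type) (m : fa_probability R T).
Implicit Types (phi psi : T -> R).

Lemma fa_measure0 : m set0 = 0.
Proof.
have := fa_measureU m (setI0 set0); rewrite setU0 => /eqP.
by rewrite -subr_eq0 opprD addrA subrr sub0r oppr_eq0 => /eqP.
Qed.

Lemma is_bounded_norm (M : R) phi : (forall x, `|phi x| <= M) -> is_bounded phi.
Proof. by move=> phiM; exists M => _ [x _ <-]. Qed.

Lemma is_bounded_indicator (A : set T) : is_bounded (fun x => (x \in A)%:R : R).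
Proof.
by apply: (@is_bounded_norm 1) => x; case: (x \in A); rewrite ?normr1 ?normr0.
Qed.

Lemma fa_integral_ge0 phi :
  is_bounded phi -> (forall x, 0 <= phi x) -> 0 <= fa_integral m phi.
Proof. by have [_ pos _] := fa_integralP m; exact: pos. Qed.

Lemma fa_integral_cst (c : R) : fa_integral m (fun=> c) = c.
Proof.
have [lin _ ind] := fa_integralP m.
(* The constant is written as [c] times the indicator of [setT] plus that of [set0], to fit the form
   of linearity. *)
have := lin c _ _ (is_bounded_indicator setT%classic) (is_bounded_indicator set0%classic).
rewrite !ind fa_measureT fa_measure0 mulr1 addr0 => cE.
by rewrite -[RHS]cE; congr fa_integral; apply/funext => x; rewrite in_setT in_set0 mulr1 addr0.
Qed.

Lemma fa_integral_le phi psi : is_bounded phi -> is_bounded psi ->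
  (forall x, phi x <= psi x) -> fa_integral m phi <= fa_integral m psi.
Proof.
move=> bphi bpsi le; have [lin _ _] := fa_integralP m.
rewrite -subr_ge0 addrC -mulN1r -lin //; apply: fa_integral_ge0 => [|x].
  case: bphi => M Mphi; case: bpsi => N Npsi.
  apply: (@is_bounded_norm (M + N)) => x; rewrite mulN1r.
  rewrite (le_trans (ler_normD _ _)) // normrN lerD //; first by apply: Mphi; exists x.
  by apply: Npsi; exists x.
by rewrite mulN1r addrC subr_ge0.
Qed.

(** Carrying both bounds lets the lemma be iterated: the inner integral of [def_1] is again a
    function with values between 0 and [C]. *)
Lemma fa_integral_itv (C : R) phi : (forall x, 0 <= phi x <= C) ->
  0 <= fa_integral m phi <= C.
Proof.
move=> phiC.
have bphi : is_bounded phi.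
  by apply: (@is_bounded_norm C) => x; have /andP[p0 p1] := phiC x; rewrite ger0_norm.
apply/andP; split; first by apply: fa_integral_ge0 => // x; have /andP[] := phiC x.
rewrite -[leRHS]fa_integral_cst; apply: fa_integral_le => // [|x].
  exact: (@is_bounded_norm `|C|).
by have /andP[] := phiC x.
Qed.

(** A function factoring through a finite type is a finite combination of indicators of fibres. *)
Lemma fa_integral_fin (F : finType) (p : T -> F) (u : F -> R) :
  fa_integral m (u \o p) = \sum_(a : F) u a * m [set x | p x = a]%classic.
Proof.
have [lin _ ind] := fa_integralP m.
pose v (s : seq F) x := \sum_(a <- s) u a * (x \in [set x | p x = a]%classic)%:R.
have vP s : is_bounded (v s) /\
    fa_integral m (v s) = \sum_(a <- s) u a * m [set x | p x = a]%classic.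
  elim: s => [|a s [bs IHs]].
    have -> : v [::] = fun=> 0 by apply/funext => x; rewrite /v big_nil.
    rewrite fa_integral_cst big_nil; split=> //.
    by apply: (@is_bounded_norm 0) => x; rewrite normr0.
  have -> : v (a :: s) = fun x => u a * (x \in [set x | p x = a]%classic)%:R + v s x.
    by apply/funext => x; rewrite /v big_cons.
  have ba := is_bounded_indicator [set x | p x = a]%classic.
  rewrite lin // ind IHs big_cons; split=> //.
  case: bs => M bM; apply: (@is_bounded_norm (`|u a| + M)) => x.
  rewrite (le_trans (ler_normD _ _)) // lerD //; last by apply: bM; exists x.
  by case: (x \in _); rewrite ?mulr1 ?mulr0 ?normr0.
have [_ <-] := vP (index_enum F); congr fa_integral; apply/funext => x.
rewrite /v (bigD1 (p x)) //= mem_set // mulr1 big1 ?addr0 // => a /eqP apx.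
by rewrite memNset ?mulr0 // => /= /esym.
Qed.

End FaIntegral.

(* Right translations of Gamma permute the fibres of a homomorphism transitively,
   so a right-invariant measure is pushed forward to the uniform one. Homomorphisms
   to Sym(n), composed as in the paper, are antihomomorphisms for MathComp's product. *)
Lemma fa_integral_image (R : realType) (Gamma : groupType) (gT : finGroupType)
    (G : {group gT}) (m : fa_probability R Gamma) (p : Gamma -> gT) (u : gT -> R) :
  right_invariant m -> (forall a b, p (a * b)%g = (p b * p a)%g) ->
  (forall g, reflect (exists c, p c = g) (g \in G)) ->
  fa_integral m (u \o p) = (\sum_(g in G) u g) / #|G|%:R.
Proof.
move=> m_inv pM GP; pose fib g := [set c | p c = g]%classic.
(* Right translation by [c] carries the fibre over [g] onto the fibre over [p c * g]. *)
have fibM g c : m (fib (p c * g)%g) = m (fib g).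
  rewrite -(m_inv (fib g) c); congr (fa_measure m _).
  apply/seteqP; split=> [b /= pb|_ [a /= <- <-]]; last by rewrite /fib /= pM.
  exists (b * c^-1)%g; last by rewrite mulgVK.
  by apply: (mulgI (p c)); rewrite -pM mulgVK.
have intE v : fa_integral m (v \o p) = (\sum_(g in G) v g) * m (fib 1%g).
  rewrite fa_integral_fin mulr_suml [RHS]big_mkcond; apply: eq_bigr => g _ /=.
  case: GP => [[c <-]|nG]; first by rewrite -[p c]mulg1 fibM mulg1.
  have -> : [set x | p x = g]%classic = set0.
    by rewrite -subset0 => c /= pc; apply: nG; exists c.
  by rewrite fa_measure0 mulr0.
(* Integrating 1 shows that the common measure of the fibres is 1 / |G|. *)
have := intE (fun=> 1); rewrite sumr_const (fa_integral_cst m 1) => mG.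
rewrite intE; congr (_ * _); apply: (mulfI (x := #|G|%:R)).
  by rewrite pnatr_eq0 -lt0n cardG_gt0.
by rewrite -mG divff // pnatr_eq0 -lt0n cardG_gt0.
Qed.

(** * Subgroups of a product of two symmetric groups, acting through the projections *)

Section PairAction.
Variables T1 T2 : finType.
Let gT := ({perm T1} * {perm T2})%type.

Let to1 (x : T1) (g : gT) := g.1 x.
Let to2 (x : T2) (g : gT) := g.2 x.

Let to1_id x : to1 x 1%g = x. Proof. exact: perm1. Qed.
Let to2_id x : to2 x 1%g = x. Proof. exact: perm1. Qed.
Let to1_morph x : act_morph to1 x. Proof. by move=> g h; exact: permM. Qed.
Let to2_morph x : act_morph to2 x. Proof. by move=> g h; exact: permM. Qed.

Lemma card_perm_agreement_le_half (G : {group gT}) (i : T2 -> T1) (x1 : T1) (x2 : T2) :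
  (forall x y : T1, exists2 g, g \in G & g.1 x = y) -> (#|T2| < #|T1|)%N ->
  (2 * #|[set g in G | g.1 x1 == i (g.2 x2)]| <= #|G|)%N.
Proof.
move=> G_trans.
apply: (@card_agreement_le_half _ _ _ _ (TotalAction to1_id to1_morph)
  (TotalAction to2_id to2_morph)).
apply/imsetP; exists x1; first by rewrite inE.
apply/setP => y; rewrite inE; apply/esym/imsetP.
by have [g gG gx] := G_trans x1 y; exists g.
Qed.

End PairAction.

(** * Averaging the distance over a finite group *)

Lemma sum_dH_Psi_ge (R : realType) (n : nat) (G : {group {perm 'I_n} * {perm 'I_n.-1}}) :
  (2 <= n)%N -> (forall x y : 'I_n, exists2 g, g \in G & g.1 x = y) ->
  (#|G|%:R * (1 / 2 - 1 / n.-1%:R) <= \sum_(g in G) dH g.2 (Psi g.1) :> R).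
Proof.
move=> n_ge2 G_trans; have k_gt0 : (0 < n.-1)%N by rewrite -subn1 subn_gt0.
pose w (x : 'I_n.-1) : 'I_n := widen_ord (leq_pred n) x.
pose a (g : {perm 'I_n} * {perm 'I_n.-1}) := #|[pred x | g.1 (w x) == w (g.2 x)]|.
(* Double counting of the pairs of [g] and [x]: each of the [n.-1] points [x] contributes at most
   |G| / 2. *)
have sum_a : (2 * \sum_(g in G) a g <= n.-1 * #|G|)%N.
  under eq_bigr => g _ do rewrite /a -sum1_card big_mkcond /=.
  have -> : (n.-1 * #|G| = \sum_(x < n.-1) #|G|)%N by rewrite sum_nat_const card_ord.
  rewrite exchange_big big_distrr /=.
  apply: leq_sum => x _; rewrite -big_mkcondr /= sum1dep_card.
  by apply: card_perm_agreement_le_half => //; rewrite !card_ord ltn_predL ltnW.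
have kR : 0 < n.-1%:R :> R by rewrite ltr0n.
have sum_aR : \sum_(g in G) ((a g)%:R / n.-1%:R) <= #|G|%:R / 2 :> R.
  rewrite -mulr_suml ler_pdivrMr // mulrAC ler_pdivlMr // -natr_sum -!natrM ler_nat.
  by rewrite mulnC (mulnC #|_|).
have sumE (u : R) (b : _ -> R) :
    \sum_(g in G) (1 - (u + b g)) = #|G|%:R * (1 - u) - \sum_(g in G) b g.
  by rewrite mulr_natl -sumr_const -sumrB; apply: eq_bigr => g _; rewrite opprD addrA.
(* [g.2] and [Psi g.1] agree on at most [a g + 1] points; this 1 becomes the loss 1 / (n - 1). *)
apply: (@le_trans _ _ (\sum_(g in G) (1 - (1 / n.-1%:R + (a g)%:R / n.-1%:R)))).
  rewrite sumE.
  by move: sum_aR; move: (\sum_(g in G) _) (#|G|%:R) (1 / n.-1%:R) => S N u; lra.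
apply: ler_sum => g _; rewrite dHE // lerD2l lerN2 -mulrDl ler_pM2r ?invr_gt0 //.
by rewrite nat1r ler_nat card_Psi_eq_le.
Qed.

Theorem theorem4p3 (R : realType) (Gamma : groupType) (n : nat) (n_ge2 : (2 <= n)%N)
    (f : Gamma -> {perm 'I_n}) (f_hom : is_sym_hom f) (f_trans : is_transitive f)
    (h : Gamma -> {perm 'I_n.-1}) (h_hom : is_sym_hom h) :
  let fhat : Gamma -> {perm 'I_n.-1} := fun c => Psi (f c) in
  ((def_infty fhat : R) <= 2 / n.-1%:R /\
   (d_infty h fhat : R) >= 1 / 2 - 1 / n.-1%:R) /\
  (forall m : fa_probability R Gamma, right_invariant m ->
     def_1 m fhat <= 2 / n.-1%:R /\
     d_1 m h fhat >= 1 / 4 - 1 / n.-1%:R).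
Proof.
move=> fhat; pose p c := (f c, h c).
have pM a b : p (a * b)%g = (p b * p a)%g by rewrite /p f_hom h_hom.
have defP a b :
    0 <= dH (R := R) (fhat (a * b)%g) (sym_mul (fhat a) (fhat b)) <= 2 / n.-1%:R.
  by rewrite dH_ge0 ler_wpM2r ?invr_ge0 // ler_nat /fhat f_hom card_Psi_mul_neq.
(* The image of [p] is a finite group, transitive on [n] through its first factor. *)
pose A := [set g | `[< exists c, p c = g >]].
have AP g : reflect (exists c, p c = g) (g \in A) by rewrite inE; exact: asboolP.
have A_group : group_set A.
  have p1 : p 1%g = 1%g by apply: (mulgI (p 1%g)); rewrite -pM !mulg1.
  apply/group_setP; split=> [|x y]; first by apply/AP; exists 1%g.
  by move=> /AP[a <-] /AP[b <-]; apply/AP; exists (b * a)%g; rewrite pM.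
pose G := Group A_group.
have GP : forall g, reflect (exists c, p c = g) (g \in G) := AP.
have G_trans (x y : 'I_n) : exists2 g, g \in G & g.1 x = y.
  by have [c cx] := f_trans x y; exists (p c) => //; apply/GP; exists c.
have sumG := sum_dH_Psi_ge R n_ge2 G_trans.
have G0 : 0 < #|G|%:R :> R by rewrite ltr0n cardG_gt0.
split; first split.
- apply: ge_sup; first by exists (dH (fhat (1 * 1)%g) (sym_mul (fhat 1%g) (fhat 1%g))); exists (1, 1)%g.
  by move=> _ [[a b] _ <-]; have /andP[] := defP a b.
(* The supremum dominates the average over [G], as every element of [G] is some [p c]. *)
- rewrite -(ler_pM2l G0) (le_trans sumG) // mulr_natl -sumr_const.
  apply: ler_sum => g /GP[c <-]; apply: ub_le_sup; last by exists c.
  by exists 1 => _ [b _ <-]; exact: dH_le1.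
- move=> m m_inv; split.
    suff /andP[] : 0 <= def_1 m fhat <= 2 / n.-1%:R by [].
    by do 2!apply: fa_integral_itv => ?.
  have -> : d_1 m h fhat = (\sum_(g in G) dH g.2 (Psi g.1)) / #|G|%:R.
    exact: (fa_integral_image (p := p) (fun g => dH g.2 (Psi g.1)) m_inv pM GP).
  (* The average is at least 1/2 - 1/(n - 1), which exceeds the bound with 1/4. *)
  by rewrite ler_pdivlMr // mulrC; apply: le_trans sumG; rewrite ler_pM2l //; lra.
Qed.
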